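(* Let $q$ be a power of an odd prime, let $n\ge 4$ be even, and let $f\in\mathbb{F}_q[x_1,\dots,x_n]$ be a non-degenerate quadratic form such that $(-1)^{n/2}\det(f)$ is a square in $\mathbb{F}_q^\times$. Let $X=V(f)\subseteq\mathbb{P}^{n-1}$. Then for every integer $P\ge 1$: if $n=4$, $$\#\mathrm{Mor}_P(\mathbb{P}^1,X)(\mathbb{F}_q)=\frac{(q^2-1)^2}{q^2}\,P\,q^{2P}+\frac{(q^2-1)(q+1)^2}{q^2}\,q^{2P},$$ and if $n\ge 6$, $$\#\mathrm{Mor}_P(\mathbb{P}^1,X)(\mathbb{F}_q)=\frac{(q^{n/2}-1)(q^{n-2}-1)(q^{n-3}-1)}{q^{n-2}(q^{n/2-2}-1)(q-1)}\,q^{P(n-2)}-\frac{(q^{n-2}-1)(q^{n/2}-1)}{q^{n/2}(q^{n/2-2}-1)}\,q^{\frac n2 P}.$$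
   Context: $\det(f)$ denotes the determinant of the symmetric matrix $A\in\mathbb{F}_q^{n\times n}$ with $f(\mathbf{x})=\mathbf{x}^TA\mathbf{x}$; non-degenerate means $\det(f)\neq0$. $\#\mathrm{Mor}_P(\mathbb{P}^1,X)(\mathbb{F}_q)$ denotes the number of morphisms $\mathbb{P}^1\to X$ of degree exactly $P$ defined over $\mathbb{F}_q$; equivalently, it is the number of vectors $(x_1,\dots,x_n)\in\mathbb{F}_q[t]^n$ with $\gcd(x_1,\dots,x_n)=1$, $\max_i\deg(x_i)=P$ and $f(x_1,\dots,x_n)=0$, counted modulo multiplication by scalars in $\mathbb{F}_q^\times$ (i.e. this number divided by $q-1$). *)

(* Defs.v *)
From HB Require Import structures.
From mathcomp Require Import all_boot all_order all_algebra all_field.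
Set Implicit Arguments. Unset Strict Implicit. Unset Printing Implicit Defensive.
Import Order.TTheory GRing.Theory Num.Theory.
Local Open Scope ring_scope.

Definition quad_eval (F : fieldType) (n : nat) (A : 'M[F]_n)
    (x : 'I_n -> {poly F}) : {poly F} :=
  \sum_(i < n) \sum_(j < n) (A i j)%:P * x i * x j.

Definition polvec (F : fieldType) (n P : nat)
    (c : {ffun 'I_n -> {ffun 'I_P.+1 -> F}}) : 'I_n -> {poly F} :=
  fun i => \poly_(j < P.+1) c i (inord j).

Definition num_prim_sols (F : finFieldType) (n : nat) (A : 'M[F]_n) (P : nat)
    : nat :=
  #|[set c : {ffun 'I_n -> {ffun 'I_P.+1 -> F}} |
      [&& size (\big[@gcdp F/0]_(i < n) polvec c i) == 1%N,
          [exists i, size (polvec c i) == P.+1]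
        & quad_eval A (polvec c) == 0]]|.

Definition num_mor (F : finFieldType) (n : nat) (A : 'M[F]_n) (P : nat) : rat :=
  (num_prim_sols A P)%:R / (#|F|.-1)%:R.

(* Main.v *)
Require Import Defs.
From HB Require Import structures.
From mathcomp Require Import all_boot all_order all_algebra all_field.
From mathcomp Require Import fingroup cyclic mxabelem zify ring lra.
Set Implicit Arguments. Unset Strict Implicit. Unset Printing Implicit Defensive.
Import Order.TTheory GRing.Theory Num.Theory.
Local Open Scope ring_scope.

(**
Over a finite field of odd order the hypothesis on the determinant makes the
form hyperbolic, so that solving [f = 0] in polynomials of size at most [s]
means solving [x_1 y_1 + ... + x_m y_m = 0]. For fixed [x] this is a linear
system in [y]; comparing the kernel of its matrix with that of the transpose
turns the count of [(x, y)] into the [m]-th moment of the number of elements in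
the kernel of a Hankel matrix attached to a linear functional on the
polynomials of size at most [2s - 1]. Along an antidiagonal [e + f = 2s] the
kernel dimension of the [e x f] Hankel matrices is convex in [e], and
transposition gives a symmetry; together they force it to drop by one at each
step below the middle until it vanishes. The case [m = 1], where the count is
obvious, then determines the distribution of the kernel dimensions, hence all
the moments. Finally every nonprimitive solution is uniquely [(t g + c) x] with
[g] monic and [x] primitive; sending it to [(c, g x)] relates the primitive
solutions to all solutions of consecutive sizes.
*)

(** * Hankel matrices and their kernels along an antidiagonal *)

Definition hankel (F : fieldType) (a : nat -> F) e f : 'M[F]_(e, f) :=
  \matrix_(i, j) a (i + j)%N.

(** Row vectors are read as coefficient lists: right multiplication by [pad_right] keeps the
    polynomial, by [pad_left] it multiplies it by ['X]. *)
Definition pad_right (F : fieldType) e : 'M[F]_(e, e.+1) :=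
  \matrix_(i, j) (i == j :> nat)%:R.

Definition pad_left (F : fieldType) e : 'M[F]_(e, e.+1) :=
  \matrix_(i, j) (i.+1 == j :> nat)%:R.

(** With [a] read as a linear functional on polynomials, this is the dimension of the space of [x]
    of size at most [e] such that [a] kills [x * h] for all [h] of size at most [f]. *)
Definition hker (F : fieldType) (a : nat -> F) e f : nat :=
  \rank (kermx (hankel a e f)).

Lemma mul_pad_right (F : fieldType) m e (x : 'M[F]_(m, e)) i (j : 'I_e.+1) (k : 'I_e) :
  j = k :> nat -> (x *m pad_right F e) i j = x i k.
Proof.
move=> jk; rewrite mxE (bigD1 k) //= mxE jk eqxx mulr1 big1 ?addr0 // => l lk.
by rewrite mxE jk val_eqE (negPf lk) mulr0.
Qed.

Lemma mul_pad_right_max (F : fieldType) m e (x : 'M[F]_(m, e)) i :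
  (x *m pad_right F e) i ord_max = 0.
Proof.
rewrite mxE big1 // => l _; rewrite mxE /= [_ == _ :> nat]ltn_eqF ?mulr0 //.
Qed.

Lemma mul_pad_left (F : fieldType) m e (x : 'M[F]_(m, e)) i (j : 'I_e.+1) (k : 'I_e) :
  j = k.+1 :> nat -> (x *m pad_left F e) i j = x i k.
Proof.
move=> jk; rewrite mxE (bigD1 k) //= mxE jk eqxx mulr1 big1 ?addr0 // => l lk.
by rewrite mxE jk eqSS val_eqE (negPf lk) mulr0.
Qed.

Lemma mul_pad_left0 (F : fieldType) m e (x : 'M[F]_(m, e)) i :
  (x *m pad_left F e) i ord0 = 0.
Proof. by rewrite mxE big1 // => l _; rewrite mxE mulr0. Qed.

Lemma pad_right_free (F : fieldType) e : row_free (pad_right F e).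
Proof.
apply/inj_row_free => x x0; apply/rowP=> k.
rewrite -(@mul_pad_right _ _ _ x 0 (widen_ord (leqnSn e) k)) //.
by rewrite x0 !mxE.
Qed.

Lemma pad_left_free (F : fieldType) e : row_free (pad_left F e).
Proof.
apply/inj_row_free => x x0; apply/rowP=> k.
by rewrite -(@mul_pad_left _ _ _ x 0 (lift ord0 k)) // x0 !mxE.
Qed.

Lemma mul_hankel0P (F : fieldType) (a : nat -> F) e f (x : 'rV[F]_e) :
  reflect (forall j, (j < f)%N -> \sum_(i < e) x 0 i * a (i + j)%N = 0)
          (x <= kermx (hankel a e f))%MS.
Proof.
apply: (iffP idP) => [/sub_kermxP/rowP h j jf|h].
  have := h (Ordinal jf); rewrite !mxE => h0; rewrite -[RHS]h0.
  by apply: eq_bigr => i _; rewrite mxE.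
apply/sub_kermxP/rowP => j; rewrite !mxE -[RHS](h j) //.
by apply: eq_bigr => i _; rewrite mxE.
Qed.

Lemma sum_pad_right (F : fieldType) (b : nat -> F) e (x : 'rV[F]_e) :
  \sum_(i < e.+1) (x *m pad_right F e) 0 i * b i = \sum_(i < e) x 0 i * b i.
Proof.
rewrite big_ord_recr /= mul_pad_right_max mul0r addr0.
by apply: eq_bigr => i _; rewrite (@mul_pad_right _ _ _ x 0 _ i).
Qed.

Lemma sum_pad_left (F : fieldType) (b : nat -> F) e (x : 'rV[F]_e) :
  \sum_(i < e.+1) (x *m pad_left F e) 0 i * b i = \sum_(i < e) x 0 i * b i.+1.
Proof.
rewrite big_ord_recl /= mul_pad_left0 mul0r add0r.
by apply: eq_bigr => i _; rewrite (@mul_pad_left _ _ _ x 0 _ i).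
Qed.

Lemma ker_hankel_pad_right (F : fieldType) (a : nat -> F) e f (x : 'rV[F]_e) :
  (x <= kermx (hankel a e f.+1))%MS ->
  (x *m pad_right F e <= kermx (hankel a e.+1 f))%MS.
Proof.
move=> /mul_hankel0P h; apply/mul_hankel0P => j jf.
by rewrite (sum_pad_right (fun i => a (i + j)%N)) h // ltnW.
Qed.

Lemma ker_hankel_pad_left (F : fieldType) (a : nat -> F) e f (x : 'rV[F]_e) :
  (x <= kermx (hankel a e f.+1))%MS ->
  (x *m pad_left F e <= kermx (hankel a e.+1 f))%MS.
Proof.
move=> /mul_hankel0P h; apply/mul_hankel0P => j jf.
rewrite (sum_pad_left (fun i => a (i + j)%N)) -[RHS](h j.+1) //.
by apply: eq_bigr => i _; rewrite addnS addSn.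
Qed.

(** The product of [x] with ['X^0] is handled by the first hypothesis, its product with ['X^(j.+1)]
    by the second. *)
Lemma ker_hankel_pad_both (F : fieldType) (a : nat -> F) e f (x : 'rV[F]_e) :
  (x *m pad_right F e <= kermx (hankel a e.+1 f.+1))%MS ->
  (x *m pad_left F e <= kermx (hankel a e.+1 f.+1))%MS ->
  (x <= kermx (hankel a e f.+2))%MS.
Proof.
move=> /mul_hankel0P hr /mul_hankel0P hl; apply/mul_hankel0P => -[|j] jf.
  by rewrite -(sum_pad_right (fun i => a (i + 0)%N)) hr.
rewrite -[RHS](hl j) // (sum_pad_left (fun i => a (i + j)%N)).
by apply: eq_bigr => i _; rewrite addnS addSn.
Qed.

Lemma mulmx_kermx_sub (F : fieldType) m n p (K : 'M[F]_(m, n)) (B : 'M[F]_(n, p))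
    q (L : 'M[F]_(q, p)) :
  (forall x : 'rV_n, (x <= K)%MS -> (x *m B <= L)%MS) -> (K *m B <= L)%MS.
Proof. by move=> h; apply/row_subP => i; rewrite row_mul h ?row_sub. Qed.

(* Multiplication by [1] and by ['X] embeds the kernel at [e.+1] into the one at
   [e.+2]; the two images meet in ['X] times the kernel at [e]. *)
Lemma hker_convex (F : fieldType) (a : nat -> F) e f :
  ((hker a e.+1 f.+1).*2 <= hker a e f.+2 + hker a e.+2 f)%N.
Proof.
rewrite /hker; set K1 := kermx (hankel a e.+1 f.+1).
set K0 := kermx _; set K2 := kermx (hankel a e.+2 f).
have s1 : (K1 *m pad_right F _ + K1 *m pad_left F _ <= K2)%MS.
  rewrite addsmx_sub; apply/andP; split; apply: mulmx_kermx_sub => x.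
    exact: ker_hankel_pad_right.
  exact: ker_hankel_pad_left.
have s2 : (K1 *m pad_right F _ :&: K1 *m pad_left F _ <=
           K0 *m pad_left F _ *m pad_right F _)%MS.
  apply/rV_subP => v; rewrite sub_capmx => /andP[/submxP[x' vx] /submxP[y' vy]].
  set x := x' *m K1; set y := y' *m K1.
  have xK : (x <= K1)%MS by apply: submxMl.
  have yK : (y <= K1)%MS by apply: submxMl.
  have {}vx : v = x *m pad_right F _ by rewrite vx mulmxA.
  have {}vy : v = y *m pad_left F _ by rewrite vy mulmxA.
  clearbody x y => {x' y'}.
  (* As a polynomial [v] is both [x] and ['X * y]. Its top coefficient vanishes, hence so does that
     of [y], and the truncation [z] of [y] loses nothing. *)
  pose z : 'rV[F]_e := \row_i y 0 (widen_ord (leqnSn e) i).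
  have xz : x = z *m pad_left F _.
    apply/rowP => j; rewrite -(@mul_pad_right _ _ _ x 0 (widen_ord (leqnSn _) j)) //.
    rewrite -vx vy; case: (unliftP ord0 j) => [k|] ->; last first.
      by rewrite (_ : widen_ord _ _ = ord0) ?mul_pad_left0 //; apply/val_inj.
    rewrite (@mul_pad_left _ _ _ y 0 _ (widen_ord (leqnSn _) k)) //.
    by rewrite (@mul_pad_left _ _ _ z 0 _ k) // !mxE.
  have yz : y = z *m pad_right F _.
    apply/rowP => j; rewrite -(@mul_pad_left _ _ _ y 0 (lift ord0 j)) //.
    case: (ltnP j e) => je.
      rewrite (@mul_pad_left _ _ _ y 0 _ j) //.
      rewrite (@mul_pad_right _ _ _ z 0 _ (Ordinal je)) // mxE.
      by congr (y 0 _); apply/val_inj.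
    have -> : j = ord_max by apply/val_inj => /=; have := ltn_ord j; lia.
    rewrite mul_pad_right_max -vy vx.
    by rewrite (_ : lift _ _ = ord_max) ?mul_pad_right_max //; apply/val_inj.
  have zK : (z <= K0)%MS by apply: ker_hankel_pad_both; rewrite -?yz -?xz.
  by rewrite vx xz !submxMr.
clearbody K0 K1 K2; have := mxrank_sum_cap (K1 *m pad_right F _) (K1 *m pad_left F _).
rewrite !mxrankMfree ?pad_left_free ?pad_right_free //.
have := mxrankS s1; have := mxrankS s2.
rewrite !mxrankMfree ?pad_left_free ?pad_right_free //.
set u := \rank (_ + _); set v := \rank (_ :&: _).
lia.
Qed.

(** If the dimensions agreed, multiplication by 1 and by ['X] would both map the smaller kernel onto
    the larger one. Each of its elements would then be ['X] times another one, which forces all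
    coefficients to vanish. *)
Lemma hker_lt (F : fieldType) (a : nat -> F) e f :
  (0 < hker a e f.+1)%N -> (hker a e f.+1 < hker a e.+1 f)%N.
Proof.
rewrite /hker; set K := kermx _; set K1 := kermx _ => K_gt0.
have sr : (K *m pad_right F _ <= K1)%MS.
  by apply: mulmx_kermx_sub => x; apply: ker_hankel_pad_right.
have sl : (K *m pad_left F _ <= K1)%MS.
  by apply: mulmx_kermx_sub => x; apply: ker_hankel_pad_left.
clearbody K K1.
have rr : \rank (K *m pad_right F _) = \rank K by rewrite mxrankMfree ?pad_right_free.
have rl : \rank (K *m pad_left F _) = \rank K by rewrite mxrankMfree ?pad_left_free.
rewrite ltn_neqAle -{2}rr mxrankS // andbT; apply/eqP => KK1.
have sK : (K *m pad_right F _ <= K *m pad_left F _)%MS.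
  by apply: (submx_trans sr); rewrite -(geq_leqif (mxrank_leqif_sup sl)) rl KK1.
(* The coefficient of index [j.+1] of [x] is that of index [j] of another element of [K]. *)
have x0 j : forall x : 'rV_e, (x <= K)%MS -> forall i : 'I_e, i = j :> nat -> x 0 i = 0.
  elim: j => [|j IH] x xK i ij.
    have /submxP[y' xy] : (x *m pad_right F _ <= K *m pad_left F _)%MS.
      by apply: submx_trans sK; rewrite submxMr.
    rewrite -(@mul_pad_right _ _ _ x 0 (widen_ord (leqnSn _) i)) // xy mulmxA.
    by rewrite (_ : widen_ord _ _ = ord0) ?mul_pad_left0 //; apply/val_inj.
  have /submxP[y' xy] : (x *m pad_right F _ <= K *m pad_left F _)%MS.
    by apply: submx_trans sK; rewrite submxMr.
  rewrite -(@mul_pad_right _ _ _ x 0 (widen_ord (leqnSn _) i)) // xy mulmxA.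
  have je : (j < e)%N by have := ltn_ord i; lia.
  by rewrite (@mul_pad_left _ _ _ _ 0 _ (Ordinal je)) // IH // submxMl.
move: K_gt0; rewrite lt0n mxrank_eq0 => /eqP; apply.
by apply/row_matrixP => k; apply/rowP => i; rewrite row0 (x0 i) ?row_sub // mxE.
Qed.

(** The transpose is the Hankel matrix of the same sequence with the sizes exchanged, and it has the
    same rank. *)
Lemma hker_tr (F : fieldType) (a : nat -> F) e f :
  (hker a e f + f = hker a f e + e)%N.
Proof.
have trH : (hankel a e f)^T = hankel a f e.
  by apply/matrixP => i j; rewrite !mxE addnC.
rewrite /hker !mxrank_ker -trH mxrank_tr.
have := rank_leq_row (hankel a e f); have := rank_leq_col (hankel a e f).
lia.
Qed.

(** Increments of a convex sequence do not decrease; the comparison of those at [e] and [e + d] is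
    written without subtraction. *)
Lemma convex_four (g : nat -> nat) S :
  (forall i, (i.+2 <= S)%N -> ((g i.+1).*2 <= g i + g i.+2)%N) ->
  forall e d, (e + d < S)%N -> (g e.+1 + g (e + d) <= g e + g (e + d).+1)%N.
Proof.
move=> cv e; elim=> [|d IH] lt; first by rewrite addn0 addnC.
have := IH; have := cv (e + d)%N; rewrite !addnS in lt *; lia.
Qed.

(** Let $\delta$ be the increment along the antidiagonal at [e]. By transposition the increment at
    [f] is $2-\delta$, and convexity gives $\delta\le 2-\delta$. *)
Lemma hker_slow (F : fieldType) (a : nat -> F) e f :
  (e <= f)%N -> (hker a e.+1 f <= (hker a e f.+1).+1)%N.
Proof.
move=> ef; pose g i := hker a i (e + f.+1 - i).
have cv i : (i.+2 <= e + f.+1)%N -> ((g i.+1).*2 <= g i + g i.+2)%N.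
  move=> iS; have [k Sk] : exists k, (e + f.+1 = i.+2 + k)%N.
    by exists (e + f.+1 - i.+2)%N; rewrite subnKC.
  rewrite /g Sk (_ : _ - i.+1 = k.+1)%N; last by lia.
  rewrite (_ : _ - i = k.+2)%N; last by lia.
  by rewrite (_ : _ - i.+2 = k)%N; [apply: hker_convex | lia].
have := @convex_four g _ cv e (f - e); rewrite subnKC // /g.
rewrite (_ : _ - e.+1 = f)%N; last by lia.
rewrite (_ : _ - f = e.+1)%N; last by lia.
rewrite (_ : _ - e = f.+1)%N; last by lia.
rewrite (_ : _ - f.+1 = e)%N; last by lia.
have := hker_tr a e f.+1; have := hker_tr a e.+1 f.
lia.
Qed.

(** [hker_lt] and [hker_slow] make each step away from the middle lower a positive dimension by
    exactly one; truncated subtraction covers the steps after it has reached zero. *)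
Lemma hker_square (F : fieldType) (a : nat -> F) s d :
  (d <= s)%N -> hker a (s - d) (s + d) = (hker a s s - d)%N.
Proof.
elim: d => [|d IH] ds; first by rewrite !subn0 addn0.
have {}IH := IH (ltnW ds).
have es : (s - d = (s - d.+1).+1)%N by lia.
rewrite addnS.
have := @hker_slow _ a (s - d.+1) (s + d); have := @hker_lt _ a (s - d.+1) (s + d).
by rewrite -es IH; lia.
Qed.

(** * Duality: from bilinear equations to moments of Hankel kernels *)

Lemma card_ker (F : finFieldType) m n (B : 'M[F]_(m, n)) :
  #|[set x : 'rV[F]_m | (x *m B == 0)%R]| = (#|F| ^ (m - \rank B))%N.
Proof.
rewrite -mxrank_ker -card_rowg; apply: eq_card => x.
by rewrite !inE; apply/eqP/sub_kermxP.
Qed.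

Lemma card_ker_tr (F : finFieldType) m n (B : 'M[F]_(m, n)) :
  (#|[set x : 'rV[F]_m | (x *m B == 0)%R]| * #|F| ^ n =
   #|F| ^ m * #|[set z : 'rV[F]_n | (z *m B^T == 0)%R]|)%N.
Proof.
rewrite !card_ker mxrank_tr -!expnD; congr (_ ^ _)%N.
have := rank_leq_row B; have := rank_leq_col B; lia.
Qed.

Lemma linear_to_mx (F : fieldType) m n (f : 'rV[F]_m -> 'rV[F]_n) :
  linear f -> exists B, forall v, f v = v *m B.
Proof.
move=> lf; pose g : {linear 'rV[F]_m -> 'rV[F]_n} :=
  HB.pack f (GRing.isLinear.Build _ _ _ _ f lf).
by exists (lin1_mx g) => v; rewrite mul_rV_lin1.
Qed.

Lemma rVpoly_sum (F : fieldType) d (x : 'rV[F]_d) :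
  rVpoly x = \sum_(k < d) x 0 k *: 'X^k.
Proof.
rewrite {1}[x]row_sum_delta linear_sum; apply: eq_bigr => k _.
by rewrite linearZ /= rVpoly_delta.
Qed.

(** The vector [al] stands for a linear functional on polynomials of size at most [D], given by its
    values on the powers of ['X] and extended by zero. *)
Definition functional_seq (F : fieldType) D (al : 'rV[F]_D) : nat -> F :=
  fun i => (rVpoly al)`_i.

(** This is where Hankel matrices enter: they are the Gram matrices of the pairing that applies a
    functional to a product. *)
Lemma pair_poly_mul (F : fieldType) e f D (al : 'rV[F]_D)
    (x : 'rV[F]_e) (y : 'rV[F]_f) : (e + f = D.+1)%N ->
  (poly_rV (rVpoly x * rVpoly y) *m al^T) 0 0 =
  \sum_(j < f) y 0 j * \sum_(k < e) x 0 k * functional_seq al (k + j).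
Proof.
move=> efD; rewrite !rVpoly_sum mulr_sumr linear_sum mulmx_suml summxE.
apply: eq_bigr => j _; rewrite mulr_suml linear_sum mulmx_suml summxE mulr_sumr.
apply: eq_bigr => k _; rewrite -scalerAl -scalerAr !linearZ /= -exprD.
have kjD : (k + j < D)%N by have := ltn_ord k; have := ltn_ord j; lia.
rewrite (_ : 'X^(k + j) = rVpoly (delta_mx 0 (Ordinal kjD))) ?rVpoly_delta //.
rewrite -rVpoly_delta rVpolyK -!scalemxAl !mxE mulrCA; congr (_ * (_ * _)).
rewrite (bigD1 (Ordinal kjD)) //= !mxE !eqxx mul1r big1 ?addr0.
  by rewrite /functional_seq (coef_rVpoly_ord al (Ordinal kjD)).
by move=> l /negPf lk; rewrite !mxE lk mul0r.
Qed.

Definition dot_poly (F : fieldType) m e f (x : 'M[F]_(m, e)) (y : 'M[F]_(m, f)) :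
    {poly F} :=
  \sum_(i < m) rVpoly (row i x) * rVpoly (row i y).

(** The two sizes are kept independent because the case [m = 1] is used along a whole
    antidiagonal. *)
Definition hyp_count (F : finFieldType) m e f : nat :=
  #|[set xy : 'M[F]_(m, e) * 'M[F]_(m, f) | dot_poly xy.1 xy.2 == 0]|.

Lemma size_dot_poly (F : fieldType) m e f (x : 'M[F]_(m, e)) (y : 'M[F]_(m, f)) D :
  (e + f = D.+1)%N -> (size (dot_poly x y) <= D)%N.
Proof.
move=> efD; apply: (leq_trans (size_sum _ _ _)); apply/bigmax_leqP => i _.
apply: (leq_trans (size_polyMleq _ _)).
have := size_poly e (fun k => if insub k is Some i0 then row i x 0 i0 else 0).
have := size_poly f (fun k => if insub k is Some i0 then row i y 0 i0 else 0).
rewrite -/(rVpoly _) -/(rVpoly _); lia.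
Qed.

(** For fixed [x] the map from [y] to [dot_poly x y] is linear. The kernel of the transposed matrix
    consists of the functionals that kill all its values, that is, those whose Hankel kernel
    contains every row of [x]. *)
Lemma dot_poly_duality (F : finFieldType) m e f D (x : 'M[F]_(m, e)) :
  (e + f = D.+1)%N ->
  (#|[set y : 'M[F]_(m, f) | (dot_poly x y == 0)%R]| * #|F| ^ D =
   #|F| ^ (m * f) *
   #|[set al : 'rV[F]_D | [forall i,
        row i x <= kermx (hankel (functional_seq al) e f)]%MS]|)%N.
Proof.
move=> efD.
pose phi (v : 'rV[F]_(m * f)) : 'rV[F]_D := poly_rV (dot_poly x (vec_mx v)).
have lphi : linear phi.
  move=> c u v; rewrite /phi -linearP; congr poly_rV.
  rewrite /dot_poly scaler_sumr -big_split; apply: eq_bigr => i _ /=.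
  by rewrite !linearP /= mulrDr scalerAr.
have [B phiB] := linear_to_mx lphi.
rewrite (_ : #|_| = #|[set v : 'rV[F]_(m * f) | v *m B == 0]|); last first.
  rewrite -(card_imset _ (can_inj (@mxvecK _ _ _))); apply: eq_card => v.
  rewrite inE -phiB /phi; apply/imsetP/eqP => [[y]|v0].
    by rewrite inE => /eqP y0 ->; rewrite mxvecK y0 linear0.
  exists (vec_mx v); rewrite ?vec_mxK // inE.
  by rewrite -(poly_rV_K (size_dot_poly x (vec_mx v) efD)) v0 linear0.
rewrite card_ker_tr; congr (_ * _)%N; apply: eq_card => al; rewrite !inE.
have pairE (y : 'M[F]_(m, f)) : (mxvec y *m B *m al^T) 0 0 =
  \sum_i \sum_(j < f) y i j * \sum_(k < e) x i k * functional_seq al (k + j).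
  rewrite -phiB /phi mxvecK linear_sum mulmx_suml summxE; apply: eq_bigr => i _.
  rewrite (pair_poly_mul al _ _ efD); apply: eq_bigr => j _; rewrite !mxE.
  by congr (_ * _); apply: eq_bigr => k _; rewrite mxE.
apply/eqP/forallP => [al0 i|h].
  apply/mul_hankel0P => j jf.
  (* Taking a matrix unit for [y] isolates the equation of row [i] and index [j]. *)
  have := pairE (delta_mx i (Ordinal jf)).
  rewrite -mulmxA -[B *m _]trmxK trmx_mul trmxK al0 trmx0 mulmx0 mxE => h0.
  rewrite [RHS]h0; set w := LHS; rewrite (bigD1 i) //= (bigD1 (Ordinal jf)) //= mxE !eqxx mul1r.
  rewrite [X in _ = _ + X]big1 ?addr0 => [|l /negPf li]; last first.
    by rewrite big1 // => j' _; rewrite mxE li mul0r.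
  rewrite [X in _ = _ + X]big1 ?addr0 => [|l /negPf li]; last first.
    by rewrite mxE li andbF mul0r.
  by apply: eq_bigr => k _; rewrite mxE.
apply/trmx_inj; rewrite trmx0 trmx_mul trmxK; apply/colP => k.
have := pairE (vec_mx (delta_mx 0 k)); rewrite vec_mxK -mulmxA -rowE mxE => ->.
rewrite [RHS]mxE big1 // => i _; rewrite big1 // => j _.
have /mul_hankel0P/(_ j (ltn_ord j)) := h i.
under eq_bigr do rewrite mxE.
by move=> ->; rewrite mulr0.
Qed.

Lemma card_rows (F : finFieldType) m e (P : pred 'rV[F]_e) :
  #|[set x : 'M[F]_(m, e) | [forall i, P (row i x)]]| = (#|P| ^ m)%N.
Proof.
transitivity #|(ffun_on P : pred {ffun 'I_m -> 'rV[F]_e})|; last first.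
  by rewrite card_ffun_on card_ord.
pose r (x : 'M[F]_(m, e)) : {ffun 'I_m -> 'rV[F]_e} := [ffun i => row i x].
have rinj : injective r.
  move=> x y /ffunP h; apply/row_matrixP => i; have := h i; by rewrite !ffunE.
rewrite -(card_imset _ rinj); apply: eq_card => g; apply/imsetP/ffun_onP.
  by case=> x; rewrite inE => /forallP h -> i; rewrite ffunE; apply: h.
move=> h; exists (\matrix_i g i); last by apply/ffunP => i; rewrite ffunE rowK.
by rewrite inE; apply/forallP => i; rewrite rowK; apply: h.
Qed.

(** Apply duality for each [x] and exchange the sums: for a fixed functional the [m] rows of [x]
    vary independently in one kernel. *)
Lemma hyp_countE (F : finFieldType) m e f D : (e + f = D.+1)%N ->
  (hyp_count F m e f * #|F| ^ D =
   #|F| ^ (m * f) *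
   \sum_(al : 'rV[F]_D) (#|F| ^ hker (functional_seq al) e f) ^ m)%N.
Proof.
move=> efD.
have -> : hyp_count F m e f =
    (\sum_(x : 'M[F]_(m, e)) #|[set y : 'M[F]_(m, f) | (dot_poly x y == 0)%R]|)%N.
  rewrite /hyp_count -sum1dep_card.
  rewrite (eq_bigl (fun xy : 'M[F]_(m, e) * 'M[F]_(m, f) =>
    predT xy.1 && (dot_poly xy.1 xy.2 == 0)%R)) //.
  rewrite -(pair_big_dep predT (fun x y => dot_poly x y == 0) (fun _ _ => 1%N)) /=.
  by apply: eq_bigr => x _; rewrite sum1dep_card.
rewrite big_distrl /=.
under eq_bigr do rewrite (dot_poly_duality _ efD).
rewrite -big_distrr /=; congr (_ * _)%N.
under eq_bigr do rewrite -sum1dep_card big_mkcond /=.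
rewrite exchange_big /=; apply: eq_bigr => al _.
rewrite -big_mkcond /= sum1dep_card.
rewrite (card_rows _ (fun u => u <= kermx (hankel (functional_seq al) e f))%MS).
congr (_ ^ _)%N; rewrite /hker -card_rowg; apply: eq_card => u.
by rewrite inE.
Qed.

(** A product of polynomials vanishes only if a factor does; the successor accounts for the pair
    [(0, 0)], which is counted twice on the right. *)
Lemma hyp_count1 (F : finFieldType) e f :
  ((hyp_count F 1 e f).+1 = #|F| ^ e + #|F| ^ f)%N.
Proof.
have -> : hyp_count F 1 e f =
    #|(setX [set (0 : 'M[F]_(1, e))] [set: 'M[F]_(1, f)]) :|:
      (setX [set: 'M[F]_(1, e)] [set (0 : 'M[F]_(1, f))])|.
  have r0 d (x : 'M[F]_(1, d)) : (rVpoly (row 0 x) == 0) = (x == 0).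
    have -> : row 0 x = x by apply/rowP => k; rewrite mxE.
    by apply/eqP/eqP => [h|->]; [rewrite -[x]rVpolyK h|]; rewrite linear0.
  apply: eq_card => -[x y]; rewrite !inE /= andbT.
  by rewrite /dot_poly big_ord1 mulf_eq0 !r0.
rewrite cardsU !cardsX !cards1 !cardsT !card_mx !mul1n muln1.
rewrite (_ : _ :&: _ = [set (0, 0)]) ?cards1.
  have q0 : (0 < #|F|)%N by apply/ltnW/finNzRing_gt1.
  by rewrite -addnBA ?expn_gt0 ?q0 // -addnS subn1 prednK ?expn_gt0 ?q0 // addnC.
by apply/setP => -[x y]; rewrite !inE andbT xpair_eqE.
Qed.

(** * Distribution of the kernel dimension of square Hankel matrices *)

Definition sqhker (F : finFieldType) p (al : 'rV[F]_(p.*2.+1)) : nat :=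
  hker (functional_seq al) p.+1 p.+1.

Lemma sqhker_le (F : finFieldType) p (al : 'rV[F]_(p.*2.+1)) : (sqhker al <= p.+1)%N.
Proof. exact: rank_leq_row. Qed.

(** This is [hyp_countE] for [m = 1] at the sizes [p.+1 - d] and [p.+1 + d], where the kernel
    dimension is [sqhker al - d] and the count is known from [hyp_count1]. *)
Lemma sum_exp_sqhker (F : finFieldType) p d : (d <= p.+1)%N ->
  let q : rat := #|F|%:R in
  \sum_(al : 'rV[F]_(p.*2.+1)) q ^+ (sqhker al - d) =
  q ^+ (p.*2.+1) + q ^+ (p - d) * (q ^+ (p.+1 - d) - 1).
Proof.
move=> dp q.
have q0 : q != 0 by rewrite pnatr_eq0 -lt0n ltnW ?finNzRing_gt1.
(* The case [d = p.+1] is treated apart because [p - d] is truncated there. *)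
move: dp; rewrite leq_eqVlt => /predU1P[->|].
  rewrite subnn expr0 subrr mulr0 addr0.
  under eq_bigr => al _ do rewrite (eqP (sqhker_le al)) expr0.
  by rewrite sumr_const card_mx mul1n natrX.
rewrite ltnS => dp.
have efD : ((p.+1 - d) + (p.+1 + d) = p.*2.+1.+1)%N by lia.
have := hyp_countE F 1 efD; rewrite mul1n.
under eq_bigr => al _ do
  rewrite expn1 (hker_square (functional_seq al) (leqW dp)) -/(sqhker al).
move=> /(congr1 (fun k : nat => k%:R : rat)); rewrite !natrM natr_sum !natrX -/q.
under [in RHS]eq_bigr => al _ do rewrite natrX -/q.
have /(congr1 (fun k : nat => k%:R : rat)) := hyp_count1 F (p.+1 - d) (p.+1 + d).
rewrite -addn1 !natrD !natrX -/q => /(canRL (addrK _)) -> h.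
apply: (mulfI (expf_neq0 (p.+1 + d) q0)); rewrite -h.
have -> : q ^+ p.*2.+1 = q ^+ (p.+1 + d) * q ^+ (p - d).
  by rewrite -exprD; congr (_ ^+ _); lia.
move: (q ^+ (p.+1 + d)) (q ^+ (p - d)) (q ^+ (p.+1 - d)) => x y z.
by ring.
Qed.

(* The second difference in [d] of [sum_exp_sqhker] isolates the [al] with
   [i < sqhker al]. *)
Lemma card_sqhker_gt (F : finFieldType) p i : (i <= p)%N ->
  #|[set al : 'rV[F]_(p.*2.+1) | (i < sqhker al)%N]|%:R =
  #|F|%:R ^+ (2 * (p - i)) :> rat.
Proof.
move=> ip; set q : rat := #|F|%:R.
have q1 : q - 1 != 0.
  by rewrite subr_eq0 pnatr_eq1 neq_ltn finNzRing_gt1 orbT.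
apply: (mulfI q1); rewrite -sum1dep_card natr_sum mulr_sumr big_mkcond /=.
rewrite (eq_bigr (fun al : 'rV[F]_(p.*2.+1) =>
  q ^+ (sqhker al - i) - q * q ^+ (sqhker al - i.+1) + (q - 1))); last first.
  move=> al _; case: ltnP => h; last first.
    rewrite (_ : sqhker al - i = 0)%N; last by lia.
    by rewrite (_ : sqhker al - i.+1 = 0)%N; [ring | lia].
  have -> : (sqhker al - i = (sqhker al - i.+1).+1)%N by lia.
  by move: (sqhker al - i.+1)%N => k; rewrite exprS; ring.
rewrite big_split sumrB /= -mulr_sumr sumr_const card_mx mul1n.
rewrite -mulr_natr natrX -/q.
have := sum_exp_sqhker F (leqW ip); have := sum_exp_sqhker F (ip : i.+1 <= p.+1)%N.
rewrite /= -/q => -> ->; rewrite subSS (subSn ip) mulnC exprM expr2.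
case: (ltnP i p) => h; last first.
  have -> : (p - i = 0)%N by lia.
  by rewrite exprS !expr0; ring.
have -> : (p - i = (p - i.+1).+1)%N by lia.
by rewrite !exprS; ring.
Qed.

(** Write $Q^k = 1 + \sum_{i<k} (Q-1)Q^i$ with [k] the kernel dimension. After exchanging sums, the
    moment only involves the numbers of functionals with [i < sqhker al]. *)
Lemma hyp_count_square (F : finFieldType) m p :
  let q : rat := #|F|%:R in let Q := q ^+ m in
  (hyp_count F m p.+1 p.+1)%:R * q ^+ (p.*2.+1) =
  Q ^+ p.+1 * (q ^+ (p.*2.+1) +
    (Q - 1) * \sum_(i < p.+1) Q ^+ i * q ^+ (2 * (p - i))).
Proof.
move=> q Q.
have efD : (p.+1 + p.+1 = p.*2.+1.+1)%N by lia.
have := hyp_countE F m efD.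
move=> /(congr1 (fun k : nat => k%:R : rat)); rewrite !natrM !natrX natr_sum -/q => ->.
rewrite exprM; congr (_ * _).
rewrite (eq_bigr (fun al : 'rV[F]_(p.*2.+1) =>
  1 + \sum_(i < p.+1) if (i < sqhker al)%N then (Q - 1) * Q ^+ i else 0)).
  rewrite big_split /= sumr_const card_mx mul1n natrX -/q; congr (_ + _).
  rewrite exchange_big mulr_sumr; apply: eq_bigr => i _ /=.
  have ip : (i <= p)%N by rewrite -ltnS.
  rewrite -big_mkcond /= sumr_const -mulr_natr mulrA; congr (_ * _).
  by rewrite -(card_sqhker_gt F ip) cardsE.
move=> al _; rewrite -/(sqhker al) !natrX -/q exprAC -/Q -big_mkcond /=.
have kp := sqhker_le al.
rewrite -(big_ord_widen _ (fun i => (Q - 1) * Q ^+ i) kp) -mulr_sumr -subrX1.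
by rewrite addrC subrK.
Qed.

(** * Reduction of the quadratic form to a sum of hyperbolic planes *)

Definition bilin (F : fieldType) n (A : 'M[F]_n) (u v : 'rV[F]_n) : F :=
  (u *m A *m v^T) 0 0.

Lemma bilinDl (F : fieldType) n (A : 'M[F]_n) u v w :
  bilin A (u + v) w = bilin A u w + bilin A v w.
Proof. by rewrite /bilin !mulmxDl mxE. Qed.

Lemma bilinZl (F : fieldType) n (A : 'M[F]_n) c u w :
  bilin A (c *: u) w = c * bilin A u w.
Proof. by rewrite /bilin -!scalemxAl mxE. Qed.

Lemma bilinC (F : fieldType) n (A : 'M[F]_n) u v :
  A^T = A -> bilin A u v = bilin A v u.
Proof.
by move=> As; rewrite /bilin -[u *m A *m _]trmxK trmx_mul trmxK mxE trmx_mul As mulmxA.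
Qed.

Lemma mulmx_bilin (F : fieldType) n (A : 'M[F]_n) k l (B : 'M[F]_(k, n))
    (D : 'M[F]_(l, n)) i j :
  (B *m A *m D^T) i j = bilin A (row i B) (row j D).
Proof.
by rewrite /bilin -row_mul !mxE; apply: eq_bigr => r _; rewrite !mxE.
Qed.

(** Fibres of squaring have at most two elements, and the fibre of 0 has only one; the latter makes
    the inequality strict. *)
Lemma double_card_squares (F : finFieldType) :
  (#|F| < (#|[set x ^+ 2 | x : F]|).*2)%N.
Proof.
set S := [set x ^+ 2 | x : F].
have S0 : 0 \in S by apply/imsetP; exists 0; rewrite ?expr0n.
have fib (y : F) : (\sum_(x | (x ^+ 2 == y)%R) 1 <= 2 - (y == 0)%R)%N.
  rewrite sum1_card; case: (pickP [pred x : F | x ^+ 2 == y]) => /= [x xy|no]; last first.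
    rewrite eq_card0 // => x; exact: no.
  case: (eqVneq y 0) => [y0|_].
    apply: (@leq_trans #|pred1 (0 : F)|); last by rewrite card1.
    apply: subset_leq_card; apply/subsetP => z zy.
    have {zy} : z ^+ 2 == y := zy; by rewrite y0 sqrf_eq0.
  apply: (@leq_trans #|[set x; - x]|); last by rewrite cards2; case: eqP.
  apply: subset_leq_card; apply/subsetP => z zy.
  have {zy} : z ^+ 2 == y := zy; by rewrite -(eqP xy) eqf_sqr !inE.
have -> : #|F| = (\sum_(y in S) \sum_(x | (x ^+ 2 == y)%R) 1)%N.
  by rewrite -sum1_card (partition_big_imset (fun x : F => x ^+ 2)).
rewrite (bigD1 0) //= (cardsD1 0) S0 add1n doubleS ltnS.
apply: (@leq_trans (1 + \sum_(y in S | (y != 0)%R) 2)).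
  apply: leq_add; first by have := fib 0; rewrite eqxx.
  by apply: leq_sum => y /andP[_ /negPf y0]; have := fib y; rewrite y0.
rewrite sum_nat_const add1n ltnS -muln2 leq_mul2r; apply/orP; right.
by apply: subset_leq_card; apply/subsetP => y; rewrite !inE andbC.
Qed.

Lemma diag3_zero (F : finFieldType) (a b c : F) : a != 0 -> b != 0 ->
  exists x y, a * x ^+ 2 + b * y ^+ 2 + c = 0.
Proof.
move=> a0 b0; pose S := [set x ^+ 2 | x : F].
pose S1 := [set a * s | s in S]; pose S2 := [set - c - b * s | s in S].
have c1 : #|S1| = #|S| by apply/card_imset/mulfI.
have c2 : #|S2| = #|S|.
  by apply: card_imset => s t /addrI /oppr_inj /(mulfI b0).
have : (0 < #|S1 :&: S2|)%N.
  (* Two sets of more than [#|F| / 2] elements meet. *)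
  have := cardsUI S1 S2; rewrite c1 c2.
  have : (#|S1 :|: S2| <= #|F|)%N by apply: max_card.
 
  have := double_card_squares F; rewrite -/S; lia.
case/card_gt0P => z; rewrite inE => /andP[/imsetP[_ /imsetP[x _ ->] zx]].
case/imsetP => _ /imsetP[y _ ->] zy; exists x, y.
by rewrite -zx zy; ring.
Qed.

Lemma nonzero_ker (F : fieldType) n p (B : 'M[F]_(n, p)) : (p < n)%N ->
  exists2 v : 'rV_n, v != 0 & v *m B = 0.
Proof.
move=> pn; have : kermx B != 0.
  rewrite -mxrank_eq0 mxrank_ker -lt0n subn_gt0.
  exact: leq_ltn_trans (rank_leq_col B) pn.
by case/rowV0Pn => v /sub_kermxP vB v0; exists v.
Qed.

Definition isotropic (F : finFieldType) n (A : 'M[F]_n) : Prop :=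
  exists2 u : 'rV[F]_n, u != 0 & bilin A u u = 0.

(** Without isotropic vectors, counting dimensions yields nonzero pairwise orthogonal [v1], [v2],
    [v3]. The form is diagonal in them, and [diag3_zero] gives an isotropic combination with
    coefficient 1 at [v3]. *)
Lemma isotropic_dim3 (F : finFieldType) n (A : 'M[F]_n) :
  (3 <= n)%N -> A^T = A -> isotropic A.
Proof.
move=> n3 As; rewrite /isotropic.
case: (pickP [pred u : 'rV[F]_n | (u != 0) && (bilin A u u == 0)]) => /=.
  by move=> u /andP[u0 /eqP uu]; exists u.
move=> no; have aniso u : u != 0 -> bilin A u u != 0.
  by move=> u0; have /negbT := no u; rewrite /= u0.
have [v1 v1_neq0 _] := @nonzero_ker _ _ _ (0 : 'M[F]_(n, 0)) (ltnW (ltnW n3)).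
have [v2 v2_neq0 v2v1] := @nonzero_ker _ _ _ (A *m v1^T) (ltnW n3).
have [v3 v3_neq0] := @nonzero_ker _ _ _ (A *m row_mx v1^T v2^T) n3.
rewrite !mul_mx_row -row_mx0 => /eq_row_mx[v3v1 v3v2].
have b21 : bilin A v2 v1 = 0 by rewrite /bilin -mulmxA v2v1 mxE.
have b31 : bilin A v3 v1 = 0 by rewrite /bilin -mulmxA v3v1 mxE.
have b32 : bilin A v3 v2 = 0 by rewrite /bilin -mulmxA v3v2 mxE.
have [x [y xy]] := diag3_zero (bilin A v3 v3) (aniso _ v1_neq0) (aniso _ v2_neq0).
pose u := x *: v1 + y *: v2 + v3.
have uv w : bilin A u w = x * bilin A v1 w + y * bilin A v2 w + bilin A v3 w.
  by rewrite !bilinDl !bilinZl.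
have b12 : bilin A v1 v2 = 0 by rewrite bilinC.
have b13 : bilin A v1 v3 = 0 by rewrite bilinC.
have b23 : bilin A v2 v3 = 0 by rewrite bilinC.
exists u; last first.
  rewrite uv (bilinC v1 u As) (bilinC v2 u As) (bilinC v3 u As) !uv.
  by rewrite b21 b31 b32 b12 b13 b23 -[RHS]xy; ring.
(* The vector [u] is nonzero since it pairs with [v3] to [bilin A v3 v3]. *)
apply: contraNneq (aniso v3 v3_neq0) => u0.
have := uv v3; rewrite u0 b13 b23 !mulr0 !add0r => <-.
by rewrite /bilin !mul0mx mxE.
Qed.

Lemma det_mx2 (R : comPzRingType) (A : 'M[R]_2) :
  \det A = A 0 0 * A 1 1 - A 0 1 * A 1 0.
Proof.
rewrite (expand_det_row _ 0) !big_ord_recl big_ord0 /cofactor !det_mx11 !mxE /=.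
transitivity (A 0 0 * ((-1) ^+ 0 * A 1 1) + (A 0 1 * ((-1) ^+ 1 * A 1 0) + 0)).
  by congr (A _ _ * (_ * A _ _) + (A _ _ * (_ * A _ _) + _)); apply/val_inj.
by rewrite expr0 expr1 mul1r mulN1r mulrN addr0.
Qed.

Lemma isotropic_dim2 (F : finFieldType) (A : 'M[F]_2) y :
  A^T = A -> y ^+ 2 = - \det A -> isotropic A.
Proof.
move=> As yA; have A10 : A 1 0 = A 0 1 by rewrite -[in LHS]As mxE.
have bE (u : 'rV[F]_2) : bilin A u u =
    A 0 0 * u 0 0 ^+ 2 + (A 0 1 * u 0 0 * u 0 1) *+ 2 + A 1 1 * u 0 1 ^+ 2.
  rewrite /bilin mxE !big_ord_recl big_ord0 !mxE !big_ord_recl !big_ord0.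
  have -> : lift ord0 ord0 = 1 :> 'I_2 by apply/val_inj.
  by rewrite !mulr2n A10; ring.
case: (eqVneq (A 0 0) 0) => [a0|a0].
  exists (delta_mx 0 0); last by rewrite bE !mxE a0 /=; ring.
  by apply/eqP => /rowP/(_ 0)/eqP; rewrite !mxE /= oner_eq0.
(* With $a, b, c$ the entries of [A], the polynomial $aX^2+2bX+c$ has the root $(y-b)/a$, because
   $y^2=b^2-ac$; the denominator is cleared. *)
exists (\row_i if i == 0 then y - A 0 1 else A 0 0).
  by apply/eqP => /rowP/(_ 1)/eqP; rewrite !mxE /= (negPf a0).
rewrite bE !mxE /= mulr2n.
have {}yA : y ^+ 2 = A 0 1 ^+ 2 - A 0 0 * A 1 1.
  by rewrite yA det_mx2 A10; ring.
transitivity (A 0 0 * (y ^+ 2 - A 0 1 ^+ 2 + A 0 0 * A 1 1)); first by ring.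
by rewrite yA; ring.
Qed.

Definition plane (F : fieldType) : 'M[F]_2 := \matrix_(i, j) (i != j)%:R.

Lemma det_plane (F : fieldType) : \det (plane F) = -1.
Proof. by rewrite det_mx2 !mxE /= !mul0r mul1r sub0r. Qed.

(** If 2 were 0, then 1 would have additive order 2, which divides the order of the field. *)
Lemma odd_card_two_neq0 (F : finFieldType) : odd #|F| -> (2 : F) != 0.
Proof.
move=> oddF; apply/eqP => two0.
have := order_dvdG (in_setT (1 : F)); rewrite cardsT => o1.
have o2 : #[1%R : F]%g = 2%N.
  apply: nt_prime_order => //; last exact: oner_neq0.
by move: o1; rewrite o2 dvdn2 oddF.
Qed.

Lemma hyperbolic_pair (F : finFieldType) n (A : 'M[F]_n) u :
  (2 : F) != 0 -> A^T = A -> A \in unitmx -> u != 0 -> bilin A u u = 0 ->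
  exists B : 'M[F]_(2, n), B *m A *m B^T = plane F.
Proof.
move=> two0 As Au u0 uu.
have uA0 : u *m A != 0 by rewrite -[0](mul0mx _ A) (can_eq (mulmxK Au)).
have [j uAj] : exists j, (u *m A) 0 j != 0.
  case: (pickP [pred j | (u *m A) 0 j != 0]) => /= [j hj|no]; first by exists j.
  case/eqP: uA0; apply/rowP => j; have /negbT := no j.
  by rewrite negbK [RHS]mxE => /eqP.
pose w0 := ((u *m A) 0 j)^-1 *: delta_mx 0 j : 'rV_n.
have uw0 : bilin A u w0 = 1.
  rewrite /bilin linearZ /= trmx_delta -scalemxAr -colE mxE.
  by rewrite [X in _ * X]mxE mulVf.
(* As [u] is isotropic, this correction keeps the pairing with [u] equal to 1 and makes [w]
   isotropic. *)
clearbody w0; pose w := w0 + (- (bilin A w0 w0 / 2)) *: u.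
have bw v : bilin A w v = bilin A w0 v - bilin A w0 w0 / 2 * bilin A u v.
  by rewrite bilinDl bilinZl mulNr.
clearbody w; have uw : bilin A u w = 1.
  by rewrite bilinC // bw uu mulr0 subr0 bilinC.
have ww : bilin A w w = 0.
  rewrite bw uw (bilinC w0 w As) bw uw0 !mulr1 -addrA -opprD.
  have -> : bilin A w0 w0 / 2 + bilin A w0 w0 / 2 = bilin A w0 w0.
    by field.
  by rewrite subrr.
have wu : bilin A w u = 1 by rewrite bilinC.
exists (\matrix_(i < 2) if i == 0 then u else w).
apply/matrixP => i k; rewrite mulmx_bilin !rowK mxE.
by case: i => [[|[|i]] //= hi]; case: k => [[|[|k]] //= hk].
Qed.

(** Stack a hyperbolic pair [B] on independent rows [W] of its orthogonal complement. As the plane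
    is non-degenerate it meets the complement trivially, so the stacked matrix is invertible. *)
Lemma split_plane (F : finFieldType) k (A : 'M[F]_(2 + k)) :
  (2 : F) != 0 -> A^T = A -> A \in unitmx -> isotropic A ->
  exists2 C : 'M[F]_(2 + k), C \in unitmx &
  exists2 A' : 'M[F]_k, A'^T = A' & C *m A *m C^T = block_mx (plane F) 0 0 A'.
Proof.
move=> two0 As Au [u u0 uu].
have [B BAB] := hyperbolic_pair two0 As Au u0 uu.
have [W Wfree WAB] : exists2 W : 'M[F]_(k, 2 + k), row_free W & W *m (A *m B^T) = 0.
  pose K := kermx (A *m B^T).
  have kK : (k <= \rank K)%N.
    by rewrite mxrank_ker; have := rank_leq_col (A *m B^T); lia.
  (* The complement has dimension at least [k]; keep [k] vectors of a basis. *)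
  exists (pid_mx k *m row_base K).
    by rewrite /row_free mxrankMfree ?row_base_free // rank_pid_mx.
  by apply/sub_kermxP; rewrite (submx_trans (submxMl _ _)) ?eq_row_base.
have BAW : B *m A *m W^T = 0.
  by apply: trmx_inj; rewrite !trmx_mul trmxK As WAB trmx0.
exists (col_mx B W); last first.
  exists (W *m A *m W^T); first by rewrite !trmx_mul trmxK As mulmxA.
  by rewrite mul_col_mx tr_col_mx mul_col_row BAB BAW -(mulmxA W) WAB.
have planeU : plane F \in unitmx by rewrite unitmxE det_plane unitrN1.
rewrite -row_free_unit; apply: inj_row_free => x.
rewrite -[x]hsubmxK mul_row_col; set x1 := lsubmx x; set x2 := rsubmx x => x0.
have x10 : x1 = 0.
  have := congr1 (fun v => v *m (A *m B^T)) x0.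
  rewrite mulmxDl -!mulmxA WAB mulmx0 addr0 mul0mx (mulmxA B) BAB => h.
  by rewrite -(mulmxK planeU x1) h mul0mx.
have x20 : x2 = 0.
  by apply: (row_free_inj Wfree); rewrite mul0mx -[RHS]x0 x10 mul0mx add0r.
by rewrite x10 x20 row_mx0.
Qed.

Fixpoint hyp_form (F : fieldType) m : 'M[F]_(m.*2) :=
  if m is m'.+1 then block_mx (plane F) 0 0 (hyp_form F m') : 'M_(2 + m'.*2)
  else 0.

(** Splitting off a plane changes the determinant by -1 and a square, so the hypothesis passes to
    the smaller form with root [y * \det C]. The square root itself provides the isotropic vector in
    dimension two; from dimension four on, dimension alone does. *)
Lemma split_form (F : finFieldType) m (A : 'M[F]_(m.*2)) (y : F) :
  (2 : F) != 0 -> A^T = A -> y != 0 -> y ^+ 2 = (-1) ^+ m * \det A ->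
  exists2 C : 'M[F]_(m.*2), C \in unitmx & C *m A *m C^T = hyp_form F m.
Proof.
move=> two0; elim: m A y => [|m IH] A y As y0 yA.
  exists 1%:M; first exact: unitmx1.
  by rewrite [LHS]flatmx0 [RHS]flatmx0.
have Au : A \in unitmx.
  rewrite unitmxE unitfE; apply: contraNneq y0 => A0.
  by rewrite -sqrf_eq0 yA A0 mulr0.
have Aiso : isotropic A.
  case: m A {IH} As yA Au => [|m] A As yA Au; last exact: isotropic_dim3.
  by apply: (@isotropic_dim2 _ A y) => //; rewrite yA expr1 mulN1r.
have [C Cu [A' A's CAC]] := @split_plane F m.*2 A two0 As Au Aiso.
have dA' : (-1) ^+ m * \det A' = (y * \det C) ^+ 2.
  have := congr1 determinant CAC.
  rewrite det_ublock det_plane !det_mulmx det_tr exprMn yA => h.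
  have -> : \det A' = - (\det C * \det A * \det C) by rewrite h; ring.
  by rewrite exprS; ring.
have yC0 : y * \det C != 0 by rewrite mulf_neq0 // -unitfE -unitmxE.
have [C' C'u C'A'C'] := IH A' _ A's yC0 (esym dA').
pose D : 'M[F]_(2 + m.*2) := block_mx 1%:M 0 0 C'.
have Du : D \in unitmx by rewrite unitmxE (@det_ublock F 2 m.*2) det1 mul1r -unitmxE.
exists (D *m C : 'M_(2 + m.*2)); first by rewrite unitmx_mul Du.
have -> : D *m C *m A *m (D *m C)^T = D *m (C *m A *m C^T) *m D^T.
  by rewrite trmx_mul !mulmxA.
rewrite CAC /D tr_block_mx !trmx0 trmx1 !mulmx_block.
by rewrite !mul0mx !mulmx0 !mulmx1 !mul1mx !addr0 !add0r C'A'C' mul0mx.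
Qed.

(** * Polynomial solutions of bounded size and change of variables *)

Definition rows_poly (F : fieldType) n s (X : 'M[F]_(n, s)) (i : 'I_n) : {poly F} :=
  rVpoly (row i X).

Definition sol_count (F : finFieldType) n (A : 'M[F]_n) s : nat :=
  #|[set X : 'M[F]_(n, s) | quad_eval A (rows_poly X) == 0]|.

Lemma quad_evalE (F : fieldType) n (A : 'M[F]_n) p :
  quad_eval A p = ((\col_i p i)^T *m map_mx polyC A *m (\col_i p i)) 0 0.
Proof.
rewrite /quad_eval mxE exchange_big /=; apply: eq_bigr => j _.
rewrite !mxE mulr_suml; apply: eq_bigr => i _.
by rewrite !mxE [p i * _]mulrC.
Qed.

Lemma col_rows_poly_mul (F : fieldType) m n s (B : 'M[F]_(m, n)) (X : 'M[F]_(n, s)) :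
  \col_i rows_poly (B *m X) i = map_mx polyC B *m \col_i rows_poly X i.
Proof.
apply/colP => i; rewrite !mxE /rows_poly row_mul mulmx_sum_row linear_sum.
by apply: eq_bigr => j _; rewrite linearZ /= !mxE mul_polyC.
Qed.

(** A constant invertible substitution acts on coefficient matrices and respects the size bound. *)
Lemma sol_count_congr (F : finFieldType) n (A C : 'M[F]_n) s :
  C \in unitmx -> sol_count (C *m A *m C^T) s = sol_count A s.
Proof.
move=> Cu; have Ctu : C^T \in unitmx by rewrite unitmx_tr.
have fb : bijective (fun X : 'M[F]_(n, s) => C^T *m X).
  by exists (fun X => invmx C^T *m X) => X; [apply: mulKmx | apply: mulKVmx].
rewrite /sol_count -[RHS](on_card_preimset (onW_bij _ fb)).
apply: eq_card => X; rewrite !inE !quad_evalE col_rows_poly_mul.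
by rewrite !map_mxM -map_trmx trmx_mul trmxK !mulmxA.
Qed.

Lemma quad_eval_block (F : fieldType) a b (A : 'M[F]_a) (D : 'M[F]_b) p :
  quad_eval (block_mx A 0 0 D) p =
  quad_eval A (p \o lshift b) + quad_eval D (p \o @rshift a b).
Proof.
rewrite /quad_eval big_split_ord /=; congr (_ + _); apply: eq_bigr => i _.
  rewrite big_split_ord /= [X in _ + X]big1 ?addr0 => [|j _].
    by apply: eq_bigr => j _; rewrite block_mxEul.
  by rewrite block_mxEur mxE !mul0r.
rewrite big_split_ord /= [X in X + _]big1 ?add0r => [|j _].
  by apply: eq_bigr => j _; rewrite block_mxEdr.
by rewrite block_mxEdl mxE !mul0r.
Qed.

Lemma double_ord_subproof m (i : 'I_m) : (i.*2 < m.*2)%N.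
Proof. by rewrite ltn_double. Qed.

Lemma doubleS_ord_subproof m (i : 'I_m) : (i.*2.+1 < m.*2)%N.
Proof. by rewrite ltn_Sdouble. Qed.

Definition even_ord m (i : 'I_m) : 'I_(m.*2) := Ordinal (double_ord_subproof i).
Definition odd_ord m (i : 'I_m) : 'I_(m.*2) := Ordinal (doubleS_ord_subproof i).

Lemma quad_eval_hyp_form (F : fieldType) m p :
  quad_eval (hyp_form F m) p =
  (\sum_(i < m) p (even_ord i) * p (odd_ord i)) *+ 2.
Proof.
elim: m p => [|m IH] p; first by rewrite /quad_eval !big_ord0 mul0rn.
rewrite [LHS](@quad_eval_block _ 2 m.*2) IH big_ord_recl mulrnDl; congr (_ + _ *+ 2).
  rewrite /quad_eval !big_ord_recl !big_ord0 !mxE /= !mul0r !add0r !addr0 !mul1r.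
  rewrite mulr2n [X in _ + X]mulrC.
  by congr (p _ * p _ + p _ * p _); apply/val_inj.
by apply: eq_bigr => i _; congr (p _ * p _); apply/val_inj.
Qed.

Lemma half_ord_subproof m (k : 'I_(m.*2)) : (k./2 < m)%N.
Proof. by have := ltn_ord k; lia. Qed.

(** Even rows become [x] and odd rows [y]; the form is twice [dot_poly], and 2 is invertible. *)
Lemma sol_count_hyp_form (F : finFieldType) m s :
  (2 : F) != 0 -> sol_count (hyp_form F m) s = hyp_count F m s s.
Proof.
move=> two0.
pose h (X : 'M[F]_(m.*2, s)) : 'M[F]_(m, s) * 'M[F]_(m, s) :=
  (\matrix_i row (even_ord i) X, \matrix_i row (odd_ord i) X).
pose half_ord (k : 'I_(m.*2)) := Ordinal (half_ord_subproof k).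
pose g (xy : 'M[F]_(m, s) * 'M[F]_(m, s)) : 'M[F]_(m.*2, s) :=
  \matrix_k row (half_ord k) (if odd k then xy.2 else xy.1).
have hb : bijective h.
  exists g => [X|[x y]].
    apply/row_matrixP => k; rewrite rowK; case: ifP => ok; rewrite rowK;
      by congr (row _ X); apply/val_inj; rewrite /=; lia.
  by congr (_, _); apply/row_matrixP => i; rewrite !rowK /= ?odd_double;
    congr (row _ _); apply/val_inj; rewrite /=; lia.
rewrite /sol_count /hyp_count -[RHS](on_card_preimset (onW_bij _ hb)).
apply: eq_card => X; rewrite !inE quad_eval_hyp_form -mulr_natl mulf_eq0.
rewrite -polyC_natr polyC_eq0 (negPf two0) /dot_poly /=.
by congr (_ == _); apply: eq_bigr => i _; rewrite !rowK.
Qed.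

(** * Greatest common divisors of families and primitive families *)

Definition gcd_fam (F : fieldType) n (p : 'I_n -> {poly F}) : {poly F} :=
  \big[@gcdp F/0]_(i < n) p i.

(** The monic normalization makes the factorization of a nonzero family into a divisor and a
    primitive family unique. *)
Definition mgcd (F : fieldType) n (p : 'I_n -> {poly F}) : {poly F} :=
  (lead_coef (gcd_fam p))^-1 *: gcd_fam p.

Definition primitive_fam (F : fieldType) n (p : 'I_n -> {poly F}) : bool :=
  size (gcd_fam p) == 1%N.

Lemma dvdp_gcd_fam (F : fieldType) n (p : 'I_n -> {poly F}) d :
  (d %| gcd_fam p) = [forall i, d %| p i].
Proof.
rewrite /gcd_fam; transitivity (all (fun i => d %| p i) (index_enum 'I_n)).
  elim: (index_enum _) => [|i r IH]; first by rewrite big_nil dvdp0.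
  by rewrite big_cons dvdp_gcd IH.
apply/allP/forallP => [h i|h i _]; last exact: h.
by apply: h; rewrite mem_index_enum.
Qed.

Lemma gcd_fam_eq0 (F : fieldType) n (p : 'I_n -> {poly F}) :
  (gcd_fam p == 0) = [forall i, p i == 0].
Proof.
by rewrite -dvd0p dvdp_gcd_fam; apply: eq_forallb => i; rewrite dvd0p.
Qed.

Lemma eq_gcd_fam (F : fieldType) n (p p' : 'I_n -> {poly F}) :
  p =1 p' -> gcd_fam p = gcd_fam p'.
Proof. by move=> pp; apply: eq_bigr. Qed.

Lemma mgcd_eqp (F : fieldType) n (p : 'I_n -> {poly F}) :
  gcd_fam p != 0 -> mgcd p %= gcd_fam p.
Proof. by move=> d0; rewrite eqp_scale // invr_eq0 lead_coef_eq0. Qed.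

Lemma mgcd_monic (F : fieldType) n (p : 'I_n -> {poly F}) :
  gcd_fam p != 0 -> mgcd p \is monic.
Proof. by move=> d0; rewrite monicE lead_coefZ mulVf // lead_coef_eq0. Qed.

(** The gcd of [p] is [e * g] for some [e]; this [e] divides every [x i], hence is constant. *)
Lemma mgcd_mul (F : fieldType) n (p x : 'I_n -> {poly F}) g :
  g \is monic -> primitive_fam x -> (forall i, p i = g * x i) -> mgcd p = g.
Proof.
move=> gm /eqP xp pE.
have g0 : g != 0 by apply: monic_neq0.
have : g %| gcd_fam p.
  by rewrite dvdp_gcd_fam; apply/forallP => i; rewrite pE dvdp_mulr.
move=> /dvdpP[e De].
have e1 : e %| gcd_fam x.
  rewrite dvdp_gcd_fam; apply/forallP => i.
  rewrite -(dvdp_mul2r _ _ g0) -De [x i * g]mulrC -pE.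
  by move: i; apply/forallP; rewrite -dvdp_gcd_fam.
have x0 : gcd_fam x != 0 by rewrite -size_poly_gt0 xp.
have /size_poly1P[c c0 ec] : size e == 1%N.
  rewrite eqn_leq -[X in (_ <= X)%N]xp dvdp_leq //= size_poly_gt0.
  by apply: contraNneq x0 => e0; rewrite -dvd0p -e0.
rewrite /mgcd De ec mul_polyC lead_coefZ (monicP gm) mulr1 scalerA mulVf //.
by rewrite scale1r.
Qed.

Lemma mgcd_dvd (F : fieldType) n (p : 'I_n -> {poly F}) i :
  gcd_fam p != 0 -> mgcd p %| p i.
Proof.
move=> d0; rewrite (eqp_dvdl _ (mgcd_eqp d0)).
by move: i; apply/forallP; rewrite -dvdp_gcd_fam.
Qed.

Lemma primitive_div_mgcd (F : fieldType) n (p : 'I_n -> {poly F}) :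
  gcd_fam p != 0 -> primitive_fam (fun i => p i %/ mgcd p).
Proof.
move=> d0; set x := fun i => _.
have g0 : mgcd p != 0 by apply: monic_neq0; apply: mgcd_monic.
have : mgcd p * gcd_fam x %| mgcd p.
  rewrite (eqp_dvdr _ (mgcd_eqp d0)) dvdp_gcd_fam; apply/forallP => i.
  rewrite -(divpK (mgcd_dvd i d0)) mulrC dvdp_mul2r //.
  by move: i; apply/forallP; rewrite -dvdp_gcd_fam.
by rewrite -{2}[mgcd p]mulr1 dvdp_mul2l // dvdp1.
Qed.

Lemma quad_eval_scale (F : fieldType) n (A : 'M[F]_n) (p x : 'I_n -> {poly F}) g :
  (forall i, p i = g * x i) -> quad_eval A p = g ^+ 2 * quad_eval A x.
Proof.
move=> pE; rewrite /quad_eval mulr_sumr; apply: eq_bigr => i _.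
by rewrite mulr_sumr; apply: eq_bigr => j _; rewrite !pE; ring.
Qed.

Lemma eq_quad_eval (F : fieldType) n (A : 'M[F]_n) (p p' : 'I_n -> {poly F}) :
  p =1 p' -> quad_eval A p = quad_eval A p'.
Proof.
by move=> pp; apply: eq_bigr => i _; apply: eq_bigr => j _; rewrite !pp.
Qed.

Definition poly_rows (F : fieldType) n s (p : 'I_n -> {poly F}) : 'M[F]_(n, s) :=
  \matrix_i poly_rV (p i).

Lemma poly_rowsK (F : fieldType) n s (p : 'I_n -> {poly F}) :
  (forall i, size (p i) <= s)%N -> rows_poly (poly_rows s p) =1 p.
Proof. by move=> ps i; rewrite /rows_poly rowK poly_rV_K. Qed.

Lemma rows_polyK (F : fieldType) n s (X : 'M[F]_(n, s)) :
  poly_rows s (rows_poly X) = X.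
Proof. by apply/row_matrixP => i; rewrite rowK rVpolyK. Qed.

Lemma rows_poly_inj (F : fieldType) n s (X Y : 'M[F]_(n, s)) :
  rows_poly X =1 rows_poly Y -> X = Y.
Proof.
move=> XY; rewrite -[X]rows_polyK -[Y]rows_polyK.
by apply/row_matrixP => i; rewrite !rowK XY.
Qed.

Lemma size_rows_poly (F : fieldType) n s (X : 'M[F]_(n, s)) i :
  (size (rows_poly X i) <= s)%N.
Proof. exact: size_poly. Qed.

(** * Primitive solutions in terms of all solutions *)

Definition nz_sols (F : finFieldType) n (A : 'M[F]_n) s : {set 'M[F]_(n, s)} :=
  [set X | (gcd_fam (rows_poly X) != 0) && (quad_eval A (rows_poly X) == 0)].

Definition prim_sols (F : finFieldType) n (A : 'M[F]_n) s : {set 'M[F]_(n, s)} :=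
  [set X | primitive_fam (rows_poly X) && (quad_eval A (rows_poly X) == 0)].

Lemma card_nz_sols (F : finFieldType) n (A : 'M[F]_n) s :
  sol_count A s = #|nz_sols A s|.+1.
Proof.
have p0 : rows_poly (0 : 'M[F]_(n, s)) =1 (fun _ => 0).
  by move=> i; rewrite /rows_poly row0 linear0.
rewrite /sol_count (cardsD1 0) inE.
have -> : quad_eval A (rows_poly (0 : 'M[F]_(n, s))) == 0.
  by rewrite (@quad_eval_scale _ _ A _ (fun _ => 0) 0) ?expr0n ?mul0r // => i; rewrite p0 mul0r.
rewrite add1n; congr _.+1; apply: eq_card => X; rewrite !inE; congr (~~ _ && _).
rewrite gcd_fam_eq0; apply/eqP/forallP => [-> i|h]; first by rewrite p0.
by apply: rows_poly_inj => i; rewrite p0; apply/eqP.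
Qed.

Lemma prim_sols_sub (F : finFieldType) n (A : 'M[F]_n) s :
  prim_sols A s \subset nz_sols A s.
Proof.
apply/subsetP => X; rewrite !inE => /andP[/eqP p1 ->].
by rewrite andbT -size_poly_gt0 p1.
Qed.

(* Writing [Y = g x] with [g] monic and [x] primitive, [(c, Y)] is sent to
   [(g * 'X + c) x]. *)
Definition shift_up (F : fieldType) n s (cY : F * 'M[F]_(n, s)) : 'M[F]_(n, s.+1) :=
  let p := rows_poly cY.2 in
  poly_rows s.+1 (fun i => p i * 'X + cY.1 *: (p i %/ mgcd p)).

Lemma monic_mulX_addC (F : fieldType) (g : {poly F}) (c : F) :
  g \is monic -> g * 'X + c%:P \is monic /\ size (g * 'X + c%:P) = (size g).+1.
Proof.
move=> gm; have g0 := monic_neq0 gm.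
have sgX : size (g * 'X) = (size g).+1 by rewrite size_mulX.
have lt : (size c%:P < size (g * 'X)%R)%N.
  by rewrite sgX ltnS (leq_trans (size_polyC_leq1 _)) ?size_poly_gt0.
by rewrite monicE lead_coefDl // size_polyDl // lead_coefMX (monicP gm).
Qed.

Lemma shift_upE (F : finFieldType) n (A : 'M[F]_n) s c (Y : 'M[F]_(n, s)) :
  Y \in nz_sols A s ->
  let g := mgcd (rows_poly Y) in
  let x := fun i => rows_poly Y i %/ g in
  [/\ g \is monic, primitive_fam x, quad_eval A x = 0,
      forall i, rows_poly Y i = g * x i &
      forall i, rows_poly (shift_up (c, Y)) i = (g * 'X + c%:P) * x i].
Proof.
rewrite inE => /andP[d0 /eqP Q0] g x.
have gm : g \is monic by apply: mgcd_monic.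
have Yx i : rows_poly Y i = g * x i by rewrite mulrC divpK // mgcd_dvd.
split => //; first exact: primitive_div_mgcd.
  have /eqP := Q0; rewrite (quad_eval_scale A Yx) mulf_eq0 expf_eq0 /=.
  by rewrite (negPf (monic_neq0 gm)) => /eqP.
move=> i; rewrite poly_rowsK => [|j] /=.
  by rewrite -/g -/(x i) {1}Yx -mul_polyC; ring.
have sY := size_rows_poly Y j.
apply: (leq_trans (size_polyD _ _)); rewrite geq_max; apply/andP; split.
  by apply: (leq_trans (size_polyMleq _ _)); rewrite size_polyX addn2.
apply: (leq_trans (size_scale_leq _ _)); apply: leqW; apply: leq_trans sY.
exact: leq_divp.
Qed.

(** [shift_up] is a bijection from pairs onto nonprimitive solutions, because a nonconstant monic
    polynomial is uniquely [g * 'X + c] with [g] monic. *)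
Lemma card_nonprim_sols (F : finFieldType) n (A : 'M[F]_n) s :
  #|nz_sols A s.+1 :\: prim_sols A s.+1| = (#|F| * #|nz_sols A s|)%N.
Proof.
rewrite -cardsT -cardsX -[RHS](card_in_imset (f := @shift_up F n s)); last first.
  move=> [c Y] [c' Y']; rewrite !in_setX /= => /andP[_ hY] /andP[_ hY'] e.
  have [gm xp _ Yx fE] := shift_upE c hY.
  have [gm' xp' _ Yx' fE'] := shift_upE c' hY'.
  have [Gm _] := monic_mulX_addC c gm; have [Gm' _] := monic_mulX_addC c' gm'.
  have eG := mgcd_mul Gm xp fE; rewrite e (mgcd_mul Gm' xp' fE') in eG.
  have cc : c = c'.
    (* The constant [c] is the value at 0 of the monic gcd of the image. *)
    by have := congr1 (fun p => p.[0]) eG; rewrite !(hornerE, mulr0, add0r).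
  have gg : mgcd (rows_poly Y) = mgcd (rows_poly Y').
    by move: eG; rewrite cc => /addIr /(mulIf (negbT (polyX_eq0 F))).
  congr (_, _) => //; apply: rows_poly_inj => i.
  rewrite Yx Yx' -gg; congr (_ * _); apply: (mulfI (monic_neq0 Gm)).
  by rewrite -fE e fE' cc -gg.
apply: eq_card => X; rewrite inE; apply/andP/imsetP.
  move=> []; rewrite !inE => npr /andP[d0 /eqP Q0].
  set G := mgcd (rows_poly X).
  pose x i := rows_poly X i %/ G.
  have Gm : G \is monic by apply: mgcd_monic.
  have Xx i : rows_poly X i = G * x i by rewrite mulrC divpK // mgcd_dvd.
  have xp : primitive_fam x by apply: primitive_div_mgcd.
  have Qx : quad_eval A x = 0.
    have /eqP := Q0; rewrite (quad_eval_scale A Xx) mulf_eq0 expf_eq0 /=.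
    by rewrite (negPf (monic_neq0 Gm)) => /eqP.
  have sG : (1 < size G)%N.
    rewrite (eqp_size (mgcd_eqp d0)) ltn_neqAle size_poly_gt0 d0 andbT eq_sym.
    by move: npr; rewrite Q0 eqxx andbT.
  have [g [c Gc]] : exists g c, G = g * 'X + c%:P.
    by elim/poly_ind: (G) => [|g c _]; [exists 0, 0; rewrite mul0r addr0|exists g, c].
  have g0 : g != 0.
    by apply: contraTneq sG => g0; rewrite Gc g0 mul0r add0r -leqNgt size_polyC_leq1.
  have sGg : size G = (size g).+1.
    rewrite Gc size_MXaddC (negPf g0) //.
  have gm : g \is monic.
    move: Gm; rewrite !monicE Gc lead_coefDl ?lead_coefMX // size_mulX //.
    by rewrite ltnS (leq_trans (size_polyC_leq1 _)) // size_poly_gt0.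
  pose Y : 'M[F]_(n, s) := poly_rows s (fun i => g * x i).
  have Yx : rows_poly Y =1 (fun i => g * x i).
    apply: poly_rowsK => i; have := size_rows_poly X i; rewrite Xx.
    case: (eqVneq (x i) 0) => [->|x0]; first by rewrite !mulr0 size_poly0.
    rewrite !size_mul ?(monic_neq0 Gm) // sGg.
    by move: (size g) (size (x i)) => a b; clear; lia.
  have gY : mgcd (rows_poly Y) = g by apply: mgcd_mul xp _.
  have hY : Y \in nz_sols A s.
    rewrite inE (quad_eval_scale A Yx) Qx mulr0 eqxx andbT gcd_fam_eq0.
    apply/forallP => Y0; move: d0; rewrite gcd_fam_eq0 => /forallP; apply => i.
    have := Y0 i; rewrite Yx mulf_eq0 (negPf g0) /= => /eqP x0.
    by rewrite Xx x0 mulr0.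
  exists (c, Y); first by rewrite in_setX in_setT.
  apply: rows_poly_inj => i; have [_ _ _ _ ->] := shift_upE c hY.
  by rewrite gY Xx -Gc Yx mulrC mulKp // mulrC.
case=> -[c Y]; rewrite in_setX /= => /andP[_ hY] ->.
have [gm xp Qx Yx fE] := shift_upE c hY.
have [Gm sG] := monic_mulX_addC c gm.
have G2 : (1 < size (mgcd (rows_poly Y) * 'X + c%:P)%R)%N.
  by rewrite sG ltnS size_poly_gt0 monic_neq0.
have Gd : mgcd (rows_poly Y) * 'X + c%:P %| gcd_fam (rows_poly (shift_up (c, Y))).
  by rewrite dvdp_gcd_fam; apply/forallP => i; rewrite fE dvdp_mulr.
have d0 : gcd_fam (rows_poly (shift_up (c, Y))) != 0.
  move: xp; rewrite /primitive_fam gcd_fam_eq0; apply: contraL => /forallP h0.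
  have -> : gcd_fam (fun i => rows_poly Y i %/ mgcd (rows_poly Y)) = 0.
    apply/eqP; rewrite gcd_fam_eq0; apply/forallP => i.
    by have := h0 i; rewrite fE mulf_eq0 (negPf (monic_neq0 Gm)).
  by rewrite size_poly0.
rewrite !inE d0 (quad_eval_scale A fE) Qx mulr0 eqxx !andbT; split => //.
by rewrite /primitive_fam neq_ltn (leq_trans G2) ?orbT // dvdp_leq.
Qed.

(** Nonzero solutions are primitive or not; the extra [#|F|] and successor account for the zero
    solution at both sizes. *)
Lemma sol_countS (F : finFieldType) n (A : 'M[F]_n) s :
  (sol_count A s.+1 + #|F| =
   #|F| * sol_count A s + #|prim_sols A s.+1|.+1)%N.
Proof.
rewrite !card_nz_sols mulnS -card_nonprim_sols.
rewrite -(cardsID (prim_sols A s.+1) (nz_sols A s.+1)).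
rewrite (setIidPr (prim_sols_sub A s.+1)); lia.
Qed.

(** A primitive solution of size at most [P.+1] either attains this size, so has degree exactly [P],
    or already has size at most [P]. *)
Lemma num_prim_solsE (F : finFieldType) n (A : 'M[F]_n) P :
  (num_prim_sols A P + #|prim_sols A P| = #|prim_sols A P.+1|)%N.
Proof.
pose top : {set 'M[F]_(n, P.+1)} := [set X | [exists i, size (rows_poly X i) == P.+1]].
rewrite -(cardsID top); congr (_ + _)%N.
  pose h (c : {ffun 'I_n -> {ffun 'I_P.+1 -> F}}) : 'M[F]_(n, P.+1) :=
    \matrix_(i, j) c i j.
  have hb : bijective h.
    pose h' (X : 'M[F]_(n, P.+1)) : {ffun 'I_n -> {ffun 'I_P.+1 -> F}} :=
      [ffun i => [ffun j => X i j]].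
    exists h' => [c|X].
      by apply/ffunP => i; apply/ffunP => j; rewrite !ffunE mxE.
    by apply/matrixP => i j; rewrite mxE !ffunE.
  rewrite /num_prim_sols -(on_card_preimset (onW_bij _ hb)); apply: eq_card => c.
  have pE : rows_poly (h c) =1 polvec c.
    move=> i; apply/polyP => k; rewrite [RHS]coef_poly.
    case: ltnP => kP; last first.
      by apply: nth_default; apply: leq_trans kP; apply: size_rows_poly.
    by rewrite (coef_rVpoly_ord _ (Ordinal kP)) !mxE; congr (c i _); apply/val_inj; rewrite /= inordK.
  rewrite !inE /primitive_fam (eq_gcd_fam pE) (eq_quad_eval A pE) -andbA.
  congr andb; rewrite andbC; congr andb.
  by apply: eq_existsb => i; rewrite pE.
pose w (X : 'M[F]_(n, P)) : 'M[F]_(n, P.+1) := poly_rows P.+1 (rows_poly X).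
have wE X : rows_poly (w X) =1 rows_poly X.
  by apply: poly_rowsK => i; apply: leqW; apply: size_rows_poly.
have winj : injective w.
  by move=> X Y e; apply: rows_poly_inj => i; rewrite -wE e wE.
rewrite -(card_imset _ winj); apply: eq_card => X; rewrite !inE negb_exists.
apply/imsetP/andP => [[Y + ->]|[/forallP st pX]].
  rewrite !inE /primitive_fam (eq_gcd_fam (wE Y)) (eq_quad_eval A (wE Y)) => ->.
  by split => //; apply/forallP => i; rewrite wE ltn_eqF // ltnS size_rows_poly.
have sX i : (size (rows_poly X i) <= P)%N.
  by rewrite -ltnS ltn_neqAle st size_rows_poly.
have YE := poly_rowsK sX.
exists (poly_rows P (rows_poly X)).
  by rewrite inE /primitive_fam (eq_gcd_fam YE) (eq_quad_eval A YE).
by apply: rows_poly_inj => i; rewrite wE YE.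
Qed.

(** * Closed formulas *)

Lemma sol_count0 (F : finFieldType) n (A : 'M[F]_n) : sol_count A 0 = 1%N.
Proof.
rewrite /sol_count -[RHS](cards1 (0 : 'M[F]_(n, 0))); apply: eq_card => X.
rewrite !inE [X]thinmx0 eqxx; apply/eqP.
rewrite (@quad_eval_scale _ _ A _ (fun _ => 0) 0) ?expr0n ?mul0r // => i.
by rewrite /rows_poly row0 linear0.
Qed.

(** Here $w=q^{n/2-2}$. The geometric sum is left open because $w=1$ when $n=4$. *)
Lemma sol_count_closed (F : finFieldType) k (A : 'M[F]_(k.+2.*2)) y s :
  (2 : F) != 0 -> A^T = A -> y != 0 -> y ^+ 2 = (-1) ^+ k.+2 * \det A ->
  let q : rat := #|F|%:R in let w := q ^+ k in
  (sol_count A s)%:R =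
  w ^+ s * q ^+ (2 * s) * (1 + (w * q ^+ 2 - 1) / q * \sum_(i < s) w ^+ i).
Proof.
move=> two0 As y0 yA q w.
have q0 : q != 0 by rewrite pnatr_eq0 -lt0n ltnW ?finNzRing_gt1.
case: s => [|p]; first by rewrite sol_count0 big_ord0 muln0 !expr0; ring.
have [C Cu CA] := split_form two0 As y0 yA.
rewrite -(sol_count_congr A p.+1 Cu) CA sol_count_hyp_form //.
have := hyp_count_square F k.+2 p; rewrite /= -/q.
have -> : q ^+ k.+2 = w * q ^+ 2 by rewrite -exprD addn2.
clearbody w.
rewrite (eq_bigr (fun i : 'I_p.+1 => q ^+ (2 * p) * w ^+ i)); last first.
  move=> i _; rewrite exprMn -exprM -mulrA -exprD mulrC; congr (_ ^+ _ * _).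
  by have := ltn_ord i; lia.
rewrite -mulr_sumr; set S := \sum_(i < _) _.
have -> : q ^+ p.*2.+1 = q * q ^+ (2 * p) by rewrite -exprS mul2n.
have -> : q ^+ (2 * p.+1) = q ^+ 2 * q ^+ (2 * p) by rewrite -exprD -mulnS.
have -> : (w * q ^+ 2) ^+ p.+1 = w ^+ p.+1 * (q ^+ 2 * q ^+ (2 * p)).
  by rewrite exprMn -exprM mulnS exprD.
have y'0 : q ^+ (2 * p) != 0 by rewrite expf_neq0.
move=> h; apply: (mulIf (mulf_neq0 q0 y'0)); rewrite {}h.
move: S (q ^+ (2 * p)) (w ^+ p.+1) y'0 => S b a b0.
clearbody q; clear -q0 b0.
by field.
Qed.

(** The numerator is $(E-1)(E-q)$ applied to [sol_count], with $E$ the shift of the size: $E-q$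
    extracts primitive solutions up to a constant, $E-1$ those of exact degree. *)
Lemma num_mor_sol_count (F : finFieldType) n (A : 'M[F]_n) P :
  let q : rat := #|F|%:R in
  num_mor A P.+1 =
  ((sol_count A P.+2)%:R - (q + 1) * (sol_count A P.+1)%:R
   + q * (sol_count A P)%:R) / (q - 1).
Proof.
move=> q; rewrite /num_mor.
have -> : (#|F|.-1)%:R = q - 1 :> rat.
  by rewrite -subn1 natrB // ltnW ?finNzRing_gt1.
congr (_ / _).
have /(congr1 (fun k : nat => k%:R : rat)) := num_prim_solsE A P.+1.
have /(congr1 (fun k : nat => k%:R : rat)) := sol_countS A P.+1.
have /(congr1 (fun k : nat => k%:R : rat)) := sol_countS A P.
rewrite !natrD !natrM -!(addn1 #|_|) !natrD -/q.
lra.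
Qed.

Theorem theorem1p1 (F : finFieldType) (n : nat) (A : 'M[F]_n) :
  odd #|F| ->
  (4 <= n)%N -> ~~ odd n ->
  A^T = A ->
  \det A != 0 ->
  (exists y : F, y != 0 /\ y ^+ 2 = (-1) ^+ (n %/ 2) * \det A) ->
  forall P : nat, (1 <= P)%N ->
    let q : rat := (#|F|)%:R in
    (n = 4%N ->
      num_mor A P =
        (q ^+ 2 - 1) ^+ 2 / q ^+ 2 * P%:R * q ^+ (2 * P)
        + (q ^+ 2 - 1) * (q + 1) ^+ 2 / q ^+ 2 * q ^+ (2 * P)) /\
    ((6 <= n)%N ->
      num_mor A P =
        (q ^+ (n %/ 2) - 1) * (q ^+ (n - 2) - 1) * (q ^+ (n - 3) - 1)
          / (q ^+ (n - 2) * (q ^+ (n %/ 2 - 2) - 1) * (q - 1))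
          * q ^+ (P * (n - 2))
        - (q ^+ (n - 2) - 1) * (q ^+ (n %/ 2) - 1)
          / (q ^+ (n %/ 2) * (q ^+ (n %/ 2 - 2) - 1))
          * q ^+ (n %/ 2 * P)).
Proof.
move=> oddF n4 evn As _ [y [y0 yA]] P P1 q.
have two0 := odd_card_two_neq0 oddF.
have q0 : q != 0 by rewrite pnatr_eq0 -lt0n ltnW ?finNzRing_gt1.
have q1 : q - 1 != 0 by rewrite subr_eq0 pnatr_eq1 neq_ltn finNzRing_gt1 orbT.
have [k nk] : exists k, n = k.+2.*2.
  by exists (n./2 - 2)%N; rewrite -{1}[n]odd_double_half (negPf evn); lia.
case: P P1 => [//|P] _.
move: A As yA; rewrite nk => A As.
have n2 : (k.+2.*2 %/ 2 = k.+2)%N by rewrite divn2 doubleK.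
rewrite n2 => yA.
rewrite num_mor_sol_count !(sol_count_closed _ two0 As y0 yA) -/q.
split=> hk.
  (* For $n=4$ the geometric sum is just the number of its terms, the source of the factor $P$. *)
  have -> : k = 0%N by lia.
  rewrite expr0 mul1r !expr1n !mul1r.
  have sum1 s : \sum_(i < s) (1 : rat) ^+ i = s%:R.
    by under eq_bigr do rewrite expr1n; rewrite sumr_const card_ord.
  rewrite !sum1.
  have -> : q ^+ (2 * P.+2) = q ^+ (2 * P) * q ^+ 4.
    by rewrite -exprD; congr (_ ^+ _); lia.
  have -> : q ^+ (2 * P.+1) = q ^+ (2 * P) * q ^+ 2.
    by rewrite -exprD; congr (_ ^+ _); lia.
  rewrite -![P.+2]addn2 -![P.+1]addn1 !natrD.
  move: (q ^+ (2 * P)) (P%:R : rat) => b r; clearbody q; clear -q0 q1.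
  by field; rewrite q0.
have k0 : (0 < k)%N by lia.
have w1 : q ^+ k - 1 != 0.
  rewrite subr_eq0 -natrX pnatr_eq1 neq_ltn; apply/orP; right.
  by rewrite -(exp1n k) ltn_exp2r // finNzRing_gt1.
have geom s : \sum_(i < s) (q ^+ k) ^+ i = ((q ^+ k) ^+ s - 1) / (q ^+ k - 1).
  by rewrite [_ ^+ s - 1]subrX1 mulrC mulKf.
have w0 : q ^+ k != 0 by rewrite expf_neq0.
rewrite !geom.
(* All powers are expressed through $q$, $q^k$, $q^{2P}$ and powers of $q^k$, so that a rational
   identity remains. *)
have -> : q ^+ (k.+2 - 2) = q ^+ k by rewrite subn2.
have -> : q ^+ k.+2 = q ^+ k * q ^+ 2 by rewrite -exprD addn2.
have -> : q ^+ (k.+2.*2 - 2) = (q ^+ k) ^+ 2 * q ^+ 2.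
  by rewrite -exprM -exprD; congr (_ ^+ _); lia.
have -> : q ^+ (k.+2.*2 - 3) = (q ^+ k) ^+ 2 * q.
  by rewrite -exprM -exprSr; congr (_ ^+ _); lia.
have -> : q ^+ (P.+1 * (k.+2.*2 - 2)) =
    ((q ^+ k) ^+ P.+1) ^+ 2 * q ^+ (2 * P) * q ^+ 2.
  by rewrite -!exprM -!exprD; congr (_ ^+ _); lia.
have -> : q ^+ (k.+2 * P.+1) = (q ^+ k) ^+ P.+1 * q ^+ (2 * P) * q ^+ 2.
  by rewrite -!exprM -!exprD; congr (_ ^+ _); lia.
have -> : q ^+ (2 * P.+2) = q ^+ (2 * P) * q ^+ 4.
  by rewrite -exprD; congr (_ ^+ _); lia.
have -> : q ^+ (2 * P.+1) = q ^+ (2 * P) * q ^+ 2.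
  by rewrite -exprD; congr (_ ^+ _); lia.
move: (q ^+ k) w0 w1 => w w0 w1; rewrite !(exprS w).
move: (q ^+ (2 * P)) (w ^+ P) => b a.
clearbody q; clear -q0 q1 w0 w1.
by field; rewrite q0 q1 w0 w1.
Qed.
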